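(* For every integer $d\ge 2$ and every integer $n\ge 3$ there exist a convex body $\mathbf{K}$ in $\mathbb{R}^d$ and an NS-family $\mathcal{K}=\{\mathbf{x}_i+\tau_i\mathbf{K} : i=1,2,\ldots,n\}$ of $n$ positive homothetic copies of $\mathbf{K}$ (with $\mathbf{x}_i\in\mathbb{R}^d$ and $\tau_i>0$) such that $\lambda(\mathcal{K})>1$; that is, no translate of $\left(\sum_{i=1}^n\tau_i\right)\mathbf{K}$ covers $\bigcup\mathcal{K}$.
   Context: A convex body in $\mathbb{R}^d$ is a compact convex subset of $\mathbb{R}^d$ with non-empty interior. A positive homothetic copy of $\mathbf{K}$ is a set $\mathbf{x}+\tau\mathbf{K}$ with $\mathbf{x}\in\mathbb{R}^d$ and $\tau>0$ (the homothety ratio). Let $\mathcal{K}=\{\mathbf{x}_i+\tau_i\mathbf{K} : i=1,\ldots,n\}$, $n\ge2$, be a finite family of positive homothetic copies of $\mathbf{K}$. $\mathcal{K}$ is called a non-separable family, in short an NS-family, if every hyperplane of $\mathbb{R}^d$ that intersects $\operatorname{conv}\left(\bigcup\mathcal{K}\right)$ intersects a member of $\mathcal{K}$ (equivalently, no hyperplane disjoint from $\bigcup\mathcal{K}$ strictly separates some members of $\mathcal{K}$ from all the other members). For an NS-family, $\lambda(\mathcal{K})>0$ denotes the smallest positive value $\lambda$ such that some translate of $\lambda\left(\sum_{i=1}^n\tau_i\right)\mathbf{K}$ covers $\bigcup\mathcal{K}$. *)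

(* Defs.v *)
From mathcomp Require Import all_boot all_order all_algebra.
From mathcomp Require Import all_classical all_reals all_analysis.

Set Implicit Arguments.
Unset Strict Implicit.
Unset Printing Implicit Defensive.

Import Order.TTheory GRing.Theory Num.Theory.
Import numFieldNormedType.Exports.

Local Open Scope classical_set_scope.
Local Open Scope ring_scope.

Section Definitions.
Context {R : realType} {d : nat}.
Implicit Types (K A H : set 'rV[R]_d).

(* The library norm on 'rV[R]_d is the sup norm; it induces the usual topology
   of R^d, and only the topology is used here. *)
Definition convex_body K : Prop :=
  [/\ compact K, convex_set K & interior K !=set0].

Definition homothet K (x : 'rV[R]_d) (tau : R) : set 'rV[R]_d :=
  [set x + tau *: y | y in K].

Definition convex_hull A : set 'rV[R]_d :=
  smallest (@convex_set R 'rV[R]_d) A.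

Definition hyperplane H : Prop :=
  exists a : 'rV[R]_d, a != 0 /\
  exists b : R, H = [set x | \sum_i a 0 i * x 0 i = b].

(* A family of n positive homothetic copies of K is given by its translation
   vectors x and its homothety ratios tau. *)
Section Families.
Context {n : nat}.
Variables (K : set 'rV[R]_d) (x : 'I_n -> 'rV[R]_d) (tau : 'I_n -> R).

Definition family_union : set 'rV[R]_d :=
  \bigcup_(i in [set: 'I_n]) homothet K (x i) (tau i).

Definition NS_family : Prop :=
  forall H, hyperplane H ->
    H `&` convex_hull family_union !=set0 ->
    exists i, H `&` homothet K (x i) (tau i) !=set0.

Definition covering_ratios : set R :=
  [set l | 0 < l /\
    exists z, family_union `<=` homothet K z (l * \sum_i tau i)].

(* lambda is the minimum, not merely the infimum, of the covering ratios. *)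
Definition is_lambda (l : R) : Prop :=
  covering_ratios l /\ lbound covering_ratios l.

End Families.
End Definitions.

(* Main.v *)
Require Import Defs.
From mathcomp Require Import all_boot all_order all_algebra.
From mathcomp Require Import all_classical all_reals all_analysis.
From mathcomp Require Import ring lra zify.

Import Order.TTheory GRing.Theory Num.Theory.
Import numFieldNormedType.Exports.

Local Open Scope classical_set_scope.
Local Open Scope ring_scope.

(** The body is the simplex of all vectors with nonnegative coordinates of sum
at most 1. Its homothets are again cut out by lower bounds on the coordinates
and an upper bound on their sum (homothet_corner_simplex), so the inclusion of
one in another is a comparison of these bounds (corner_simplex_sub), and the
smallest homothet containing a family is read off from the extreme bounds.

Three homothets of ratio t = 8/25 are arranged like a windmill. In barycentric
coordinates of the 2-face spanned by 0 and the first two unit vectors, their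
lower bounds are the three cyclic shifts of (0, p, q), with p = 10/25,
q = 7/25 and t = 1 - p - q. Each side of the face is touched by one of them,
so any homothet containing them has ratio at least 1 (windmill_cover), whereas
3 t = 24/25 < 1. All further members are tiny and lie inside the first one, so
that they change neither the union nor the smallest cover, and their ratios
add up to less than the missing 1/25 (windmill_ratio_sum).

The family is non-separable because a hyperplane H missing all members leaves
each member, being convex, on one side (convex_one_side), and the three large
members cannot be distributed over both sides (windmill_same_side): that would
be a strict separation of one triangle of the windmill from the other two in
the plane of the face. Hence the whole union lies on one side of H, and so does
its convex hull (convex_hull_side).

To see where p and q come from, project the windmill along a linear form that
ranges over [0, 1] on the face. The projected triangles are intervals of length
t, and the largest gap between the left endpoints of consecutive ones, over
all forms, is p - q + q^2 / p, provided that q <= p. It is at most t exactly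
when 2 p^2 + q^2 <= p, while 3 t < 1 means p + q > 2/3. The pair
(2/5, 7/25) satisfies both. In higher dimension the remaining vertices of the
simplex can only enlarge the projections of the members. *)

(** * Half-spaces *)

Definition dot {R : realType} {d : nat} (a x : 'rV[R]_d) : R :=
  \sum_i a 0 i * x 0 i.

Lemma dotD {R : realType} {d : nat} (a x y : 'rV[R]_d) :
  dot a (x + y) = dot a x + dot a y.
Proof.
rewrite /dot -big_split; apply: eq_bigr => i _.
by rewrite mxE mulrDr.
Qed.

Lemma dotZ {R : realType} {d : nat} (a x : 'rV[R]_d) (t : R) :
  dot a (t *: x) = t * dot a x.
Proof.
rewrite /dot big_distrr; apply: eq_bigr => i _ /=.
by rewrite mxE mulrCA.
Qed.

Lemma dotNl {R : realType} {d : nat} (a x : 'rV[R]_d) :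
  dot (- a) x = - dot a x.
Proof. by rewrite /dot -sumrN; apply: eq_bigr => i _; rewrite mxE mulNr. Qed.

Lemma dot_delta {R : realType} {d : nat} (a : 'rV[R]_d) (k : 'I_d) :
  dot a (delta_mx 0 k) = a 0 k.
Proof.
rewrite /dot (bigD1 k) //= big1 => [|i /negbTE ik].
  by rewrite mxE !eqxx mulr1 addr0.
by rewrite mxE ik andbF mulr0.
Qed.

Lemma continuous_dot {R : realType} {d : nat} (a : 'rV[R]_d) :
  continuous (dot a).
Proof.
apply: continuous_big => [|i _ x]; first exact: add_continuous.
by apply: continuousM; [exact: cst_continuous | exact: coord_continuous].
Qed.

Lemma convex_hull_side {R : realType} {d : nat} (A : set 'rV[R]_d)
    (a : 'rV[R]_d) (b : R) :
  (forall y, A y -> dot a y < b) ->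
  forall y, convex_hull A y -> dot a y < b.
Proof.
move=> Ab; apply: (@smallest_sub _ _ _ [set y | dot a y < b]) => //.
apply/convex_setW => y z; rewrite !inE /= => yb zb t t0 t1.
rewrite inE /= dotD !dotZ /unstable.onem; nra.
Qed.

(** If one point of A were below b and another above, the point of the segment
between them that cuts it in the ratio of the two distances to b would lie on
the hyperplane. *)
Lemma convex_one_side {R : realType} {d : nat} (A : set 'rV[R]_d)
    (a : 'rV[R]_d) (b : R) :
  convex_set A -> (forall y, A y -> dot a y <> b) ->
  (forall y, A y -> dot a y < b) \/ (forall y, A y -> b < dot a y).
Proof.
move=> cA Ab.
have [//|nleft] := pselect (forall y, A y -> dot a y < b); first by left.
right=> z Az; have [//|bz|/esym /(Ab z Az)//] := ltgtP b (dot a z).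
case: nleft => y Ay; have [//|by_|/(Ab y Ay)//] := ltgtP (dot a y) b.
(* The weight of y at which the form takes the value b. *)
pose t := (b - dot a z) / (dot a y - dot a z).
have t0 : 0 <= t by rewrite divr_ge0 //; lra.
have t1 : t <= 1 by rewrite ler_pdivrMr; lra.
have := cA y z (Itv01 t0 t1); rewrite !inE => /(_ Ay Az) /Ab [].
rewrite dotD !dotZ /= /unstable.onem /t; field; lra.
Qed.

(** * Homothets of a simplex *)

(** For t > 0 this is x + t K, where K is the simplex spanned by 0 and the unit
vectors; x is the vertex that minimizes every coordinate. *)
Definition corner_simplex {R : realType} {d : nat} (x : 'rV[R]_d) (t : R) :
    set 'rV[R]_d :=
  [set y | (forall k, x 0 k <= y 0 k) /\ \sum_k y 0 k <= \sum_k x 0 k + t].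

Lemma coord_sumZ {R : realType} {d : nat} (x : 'rV[R]_d) (t : R) :
  \sum_k (t *: x) 0 k = t * \sum_k x 0 k.
Proof. by rewrite big_distrr; apply: eq_bigr => k _; rewrite mxE. Qed.

Lemma coord_sumD {R : realType} {d : nat} (x y : 'rV[R]_d) :
  \sum_k (x + y) 0 k = \sum_k x 0 k + \sum_k y 0 k.
Proof. by rewrite -big_split; apply: eq_bigr => k _; rewrite mxE. Qed.

Lemma coord_sum_delta {R : realType} {d : nat} (k : 'I_d) :
  \sum_i (delta_mx 0 k : 'rV[R]_d) 0 i = 1.
Proof.
rewrite (bigD1 k) //= big1 => [|i /negbTE ik]; first by rewrite mxE !eqxx addr0.
by rewrite mxE ik andbF.
Qed.

Lemma homothet_corner_simplex {R : realType} {d : nat} (x : 'rV[R]_d) (t : R) :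
  0 < t -> homothet (corner_simplex 0 1) x t = corner_simplex x t.
Proof.
move=> t0; apply/seteqP; split=> [_ [y [y0 y1] <-]|y [xy ys]].
  split=> [k|].
    by rewrite !mxE lerDl mulr_ge0 ?(ltW t0) //; move: (y0 k); rewrite mxE.
  rewrite coord_sumD coord_sumZ lerD2l -[leRHS]mulr1 ler_pM2l //.
  by move: y1; rewrite [in leRHS]big1 ?add0r // => k _; rewrite mxE.
exists (t^-1 *: (y - x)); last first.
  by rewrite scalerA divff ?gt_eqF // scale1r addrC subrK.
split=> [k|].
  by rewrite !mxE mulr_ge0 ?invr_ge0 ?(ltW t0) ?subr_ge0.
rewrite coord_sumZ ler_pdivrMl // coord_sumD [in leRHS]big1 => [|k _];
  last by rewrite mxE.
rewrite -scaleN1r coord_sumZ; lra.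
Qed.

Lemma corner_simplex_mem {R : realType} {d : nat} (x : 'rV[R]_d) (t s : R)
    (k : 'I_d) :
  0 <= s -> s <= t -> corner_simplex x t (x + s *: delta_mx 0 k).
Proof.
move=> s0 st; split=> [i|]; last by rewrite coord_sumD coord_sumZ coord_sum_delta; lra.
by rewrite !mxE lerDl mulr_ge0 // ler0n.
Qed.

Lemma corner_simplex_corner {R : realType} {d : nat} (x : 'rV[R]_d) (t : R) :
  0 <= t -> corner_simplex x t x.
Proof. by move=> t0; split=> //; rewrite lerDl. Qed.

(** The corner x minimizes every coordinate, and the vertices x + t e_k maximize
the coordinate sum, so these points alone decide the inclusion. *)
Lemma corner_simplex_sub {R : realType} {d : nat} (x z : 'rV[R]_d) (t s : R) :
  (0 < d)%N -> 0 <= t ->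
  corner_simplex x t `<=` corner_simplex z s <->
  (forall k, z 0 k <= x 0 k) /\ \sum_k x 0 k + t <= \sum_k z 0 k + s.
Proof.
move=> d0 t0; split=> [xz|[zx st] y [xy ys]]; last first.
  by split=> [k|]; [exact: le_trans (zx k) (xy k) | exact: le_trans ys st].
have [zx _] := xz _ (corner_simplex_corner x t t0).
have [_] := xz _ (corner_simplex_mem x t t (Ordinal d0) t0 (lexx t)).
by rewrite coord_sumD coord_sumZ coord_sum_delta mulr1.
Qed.

Lemma corner_simplex_inj {R : realType} {d : nat} (x z : 'rV[R]_d) (t s : R) :
  (0 < d)%N -> 0 <= t -> 0 <= s ->
  corner_simplex x t = corner_simplex z s -> x = z /\ t = s.
Proof.
move=> d0 t0 s0 e.
have /(corner_simplex_sub _ _ _ _ d0 t0)[zx ts] :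
  corner_simplex x t `<=` corner_simplex z s by rewrite e.
have /(corner_simplex_sub _ _ _ _ d0 s0)[xz st] :
  corner_simplex z s `<=` corner_simplex x t by rewrite e.
have exz : x = z by apply/rowP => k; apply/le_anti; rewrite zx xz.
by split=> //; move: ts st; rewrite exz; lra.
Qed.

Lemma corner_simplex_convex {R : realType} {d : nat} (x : 'rV[R]_d) (t : R) :
  convex_set (corner_simplex x t).
Proof.
apply/convex_setW => y z; rewrite !inE => -[xy yt] [xz zt] l l0 l1.
rewrite inE; split=> [k|]; last by rewrite coord_sumD !coord_sumZ /unstable.onem; nra.
by rewrite !mxE /unstable.onem; move: (xy k) (xz k); nra.
Qed.

(** Compactness comes from a closed subset of the unit cube, and the interior
point is the centre of a cube with side 1/d that has 0 as a vertex. *)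
Lemma corner_simplex_convex_body {R : realType} {d : nat} :
  (0 < d)%N -> convex_body (corner_simplex (0 : 'rV[R]_d) 1).
Proof.
move=> d0.
have sum0 : \sum_k (0 : 'rV[R]_d) 0 k = 0 by rewrite big1 // => k _; rewrite mxE.
split; last 1 first.
- pose c : R := (2 * d%:R)^-1.
  have dR : 0 < d%:R :> R by rewrite ltr0n.
  have c0 : 0 < c by rewrite invr_gt0 mulr_gt0.
  exists (const_mx c); apply/nbhs_ballP; exists c => //= y [_ cy].
  have yk k : 0 < y 0 k < 2 * c.
    by have := cy 0 k; rewrite mxE /ball /= ltr_norml => /andP[]; lra.
  split=> [k|]; first by rewrite mxE ltW //; case/andP: (yk k).
  rewrite sum0 add0r; apply: (@le_trans _ _ (\sum_(k < d) 2 * c)).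
    by apply: ler_sum => k _; rewrite ltW //; case/andP: (yk k).
  rewrite sumr_const card_ord -mulr_natr /c le_eqVlt; apply/orP; left.
  by apply/eqP; field; rewrite gt_eqF.
- have -> : corner_simplex (0 : 'rV[R]_d) 1 =
      \bigcap_(k in [set: 'I_d]) [set y : 'rV[R]_d | 0 <= y 0 k] `&`
      [set y | dot (const_mx 1) y <= 1].
    apply/seteqP; split=> y [] y0 y1; split.
    + by move=> k _ /=; move: (y0 k); rewrite mxE.
    + move: y1; rewrite sum0 add0r /dot /=.
      by under [in X in _ -> X]eq_bigr do rewrite mxE mul1r.
    + by move=> k; rewrite mxE; exact: y0.
    + by move: y1; rewrite sum0 add0r /dot /=; under eq_bigr do rewrite mxE mul1r.
  apply: (@subclosed_compact _ _
    [set y : 'rV[R]_d | forall k, y ord0 k \in `[(0 : R), 1]]).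
  + apply: closedI.
      apply: closed_bigI => k _.
      apply: (@preimage_closed _ _ (fun y : 'rV[R]_d => y 0 k) [set t | 0 <= t]);
        last exact: closed_ge.
      by move=> y _; exact: coord_continuous.
    apply: (@preimage_closed _ _ (dot (const_mx 1)) [set t | t <= 1]);
      last exact: closed_le.
    by move=> y _; exact: continuous_dot.
  + apply: (@rV_compact _ _ (fun=> `[(0 : R), 1]%classic)) => _.
    exact: segment_compact.
  + move=> y [y0 y1] k; rewrite in_itv /= (y0 k I) /=.
    apply: le_trans y1; rewrite /dot (bigD1 k) //= mxE mul1r lerDl.
    by apply: sumr_ge0 => i _; rewrite mxE mul1r; exact: y0.
- exact: corner_simplex_convex.
Qed.

(** * The windmill *)

(** The corners are placed in the plane of the first two coordinates. Every
index other than 1 and 2 shares the corner of index 0, since the additional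
members are to lie inside the first one. *)
Definition windmill_corner {R : realType} (d i : nat) : 'rV[R]_d.+2 :=
  let: (p, q) := if i == 1%N then (7 / 25, 0)
                 else if i == 2%N then (10 / 25, 7 / 25) else (0, 10 / 25) in
  p *: delta_mx 0 0 + q *: delta_mx 0 1.

(** The ratios with index at least 3 are pairwise distinct, which keeps the
members with a common corner distinct, and each is at most 1/(25 n), which
bounds their sum. *)
Definition windmill_ratio {R : realType} (n i : nat) : R :=
  if (i < 3)%N then 8 / 25 else (25 * (n + i)%:R)^-1.

Lemma windmill_corner_ge0 {R : realType} (d i : nat) k :
  0 <= windmill_corner d i 0 k :> R.
Proof.
rewrite /windmill_corner; case: ifP => _; last case: ifP => _;
  by rewrite !mxE addr_ge0 // mulr_ge0 ?ler0n //; lra.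
Qed.

Lemma windmill_corner_sum {R : realType} (d i : nat) :
  \sum_k windmill_corner d i 0 k + 8 / 25 <= 1 :> R.
Proof.
rewrite /windmill_corner; case: ifP => _; last case: ifP => _;
  rewrite coord_sumD !coord_sumZ !coord_sum_delta; lra.
Qed.

Lemma windmill_ratio_gt0 {R : realType} (n i : nat) :
  0 < windmill_ratio n i :> R.
Proof.
rewrite /windmill_ratio; case: ltnP => i3; first by lra.
by rewrite invr_gt0 mulr_gt0 // ltr0n addn_gt0 (leq_trans _ i3) ?orbT.
Qed.

Lemma windmill_ratio_small {R : realType} (n i : nat) :
  (0 < n)%N -> (3 <= i)%N -> windmill_ratio n i <= (25 * n%:R)^-1 :> R.
Proof.
move=> n0 i3; have nR : 0 < n%:R :> R by rewrite ltr0n.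
rewrite /windmill_ratio ltnNge i3 /= lef_pV2 ?posrE ?mulr_gt0 ?ltr0n ?addn_gt0 ?n0 //.
by rewrite ler_pM2l // ler_nat leq_addr.
Qed.

Lemma windmill_ratio_le {R : realType} (n i : nat) :
  (0 < n)%N -> windmill_ratio n i <= 8 / 25 :> R.
Proof.
move=> n0; have [i3|i3] := ltnP i 3; first by rewrite /windmill_ratio i3.
apply: le_trans (windmill_ratio_small n i n0 i3) _.
have : 1 <= n%:R :> R by rewrite ler1n.
move=> n1; apply: (@le_trans _ _ 25^-1); last lra.
by rewrite lef_pV2 ?posrE; lra.
Qed.

Lemma windmill_ratio_sum {R : realType} (n : nat) :
  (3 <= n)%N -> \sum_(i < n) windmill_ratio n i < 1 :> R.
Proof.
case: n => [|[|[|m]]] // _; rewrite 3!big_ord_recl /=.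
rewrite /bump /= !add1n.
have -> : windmill_ratio m.+3 0 = 8 / 25 :> R by [].
have -> : windmill_ratio m.+3 1 = 8 / 25 :> R by [].
have -> : windmill_ratio m.+3 2 = 8 / 25 :> R by [].
suff : \sum_(i < m) windmill_ratio m.+3 i.+3 < 25^-1 :> R by lra.
apply: (@le_lt_trans _ _ (\sum_(i < m) (25 * m.+3%:R)^-1)).
  by apply: ler_sum => i _; exact: windmill_ratio_small.
rewrite sumr_const card_ord -[_ *+ m]mulr_natl invfM mulrCA gtr_pMr ?invr_gt0 //.
by rewrite ltr_pdivrMr ?ltr0n // mul1r ltr_nat; lia.
Qed.

Lemma windmill_inj {R : realType} (d n i j : nat) : (0 < n)%N ->
  windmill_corner d i = windmill_corner d j :> 'rV[R]_d.+2 ->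
  windmill_ratio n i = windmill_ratio n j :> R -> i = j.
Proof.
move=> n0.
have small k : (3 <= k)%N -> windmill_ratio n k < 8 / 25 :> R.
  move=> k3; apply: le_lt_trans (windmill_ratio_small n k n0 k3) _.
  have n1 : 1 <= n%:R :> R by rewrite ler1n.
  apply: (@le_lt_trans _ _ 25^-1); last lra.
  by rewrite lef_pV2 ?posrE; lra.
have [i3|i3] := ltnP i 3; have [j3|j3] := ltnP j 3.
- move=> /rowP e _; move: (e 0) (e 1).
  by move: i j i3 j3 {e} => [|[|[|//]]] [|[|[|//]]] // _ _;
    rewrite /windmill_corner !mxE /= => ? ?; exfalso; lra.
- by move=> _ e; move: (small j j3); rewrite -e /windmill_ratio i3 ltxx.
- by move=> _ e; move: (small i i3); rewrite e /windmill_ratio j3 ltxx.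
- rewrite /windmill_ratio (ltnNge i 3) (ltnNge j 3) i3 j3 /= => _ /invr_inj.
  move=> /(mulfI _) e; by apply/eqP; rewrite -(eqn_add2l n) -(eqr_nat R) e.
Qed.

(** For each of the six ways to put the three triangles on both sides of the
hyperplane, the nine strict inequalities at the vertices are linear in the
first two coefficients of the form and in b, and they are contradictory. *)
Lemma windmill_same_side {R : realType} (d : nat) (a : 'rV[R]_d.+2) (b : R) :
  let T i := corner_simplex (windmill_corner d i) (8 / 25) in
  (forall i, (i < 3)%N -> forall y, T i y -> dot a y <> b) ->
  (forall i, (i < 3)%N -> forall y, T i y -> dot a y < b) \/
  (forall i, (i < 3)%N -> forall y, T i y -> b < dot a y).
Proof.
move=> T Tb.
have side i : (i < 3)%N -> _ := fun i3 =>
  convex_one_side (T i) a b (corner_simplex_convex _ _) (Tb i i3).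
have vertices (P : 'rV[R]_d.+2 -> Prop) i : (forall y, T i y -> P y) ->
  [/\ P (windmill_corner d i), P (windmill_corner d i + (8 / 25) *: delta_mx 0 0)
    & P (windmill_corner d i + (8 / 25) *: delta_mx 0 1)].
  move=> TP; split; apply: TP; first by apply: corner_simplex_corner; lra.
  - by apply: corner_simplex_mem; lra.
  - by apply: corner_simplex_mem; lra.
case: (side 0%N isT) (side 1%N isT) (side 2%N isT) =>
  T0 [] T1 [] T2; by [left=> -[|[|[|]]]|right=> -[|[|[|]]]|
  move: (vertices _ _ T0) (vertices _ _ T1) (vertices _ _ T2);
  rewrite /windmill_corner /= !dotD !dotZ !dot_delta => -[? ? ?] [? ? ?] [? ? ?]; lra].
Qed.

(** Coordinate 1 vanishes at the corner of triangle 1 and every other coordinate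
at that of triangle 0, so all coordinates of z are nonpositive, while triangle 2
reaches the coordinate sum 1. *)
Lemma windmill_cover {R : realType} (d : nat) (z : 'rV[R]_d.+2) (s : R) :
  (forall i, (i < 3)%N ->
    corner_simplex (windmill_corner d i) (8 / 25) `<=` corner_simplex z s) ->
  1 <= s.
Proof.
have t0 : 0 <= 8 / 25 :> R by lra.
move=> cov; have {}cov i (i3 : (i < 3)%N) :=
  (corner_simplex_sub _ _ _ _ (ltn0Sn _) t0).1 (cov i i3).
have z0 k : z 0 k <= 0.
  have [k1|k1] := eqVneq k 1.
    have [zx _] := cov 1%N isT; move: (zx k).
    by rewrite k1 /windmill_corner !mxE /= mul0r mulr0 addr0.
  have [zx _] := cov 0%N isT; move: (zx k).
  by rewrite /windmill_corner !mxE /= (negbTE k1) mul0r mulr0 addr0.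
have sz : \sum_k z 0 k <= 0 by apply: sumr_le0 => k _; exact: z0.
have [_] := cov 2%N isT.
rewrite /windmill_corner /= coord_sumD !coord_sumZ !coord_sum_delta; lra.
Qed.

Lemma windmill_member_sub {R : realType} (d n i : nat) : (0 < n)%N ->
  exists2 j, (j < 3)%N &
    corner_simplex (windmill_corner d i) (windmill_ratio n i) `<=`
    corner_simplex (windmill_corner d j : 'rV[R]_d.+2) (8 / 25).
Proof.
move=> n0; have [i3|i3] := ltnP i 3.
  by exists i => //; rewrite /windmill_ratio i3.
exists 0%N => //; have -> : windmill_corner d i = windmill_corner d 0 :> 'rV[R]_d.+2.
  by move: i i3 => [|[|[|i]]].
apply/corner_simplex_sub => //; first exact/ltW/windmill_ratio_gt0.
by rewrite lerD2l windmill_ratio_le.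
Qed.

Lemma windmill_sub_simplex {R : realType} (d n i : nat) : (0 < n)%N ->
  corner_simplex (windmill_corner d i) (windmill_ratio n i) `<=`
  corner_simplex (0 : 'rV[R]_d.+2) 1.
Proof.
move=> n0; apply/corner_simplex_sub => //; first exact/ltW/windmill_ratio_gt0.
split=> [k|]; first by rewrite mxE windmill_corner_ge0.
rewrite [in leRHS]big1 ?add0r; last by move=> k _; rewrite mxE.
by apply: le_trans (windmill_corner_sum d i); rewrite lerD2l windmill_ratio_le.
Qed.

Theorem mainTheorem1 (R : realType) (d n : nat)
    (hd : (2 <= d)%N) (hn : (3 <= n)%N) :
  exists (K : set 'rV[R]_d) (x : 'I_n -> 'rV[R]_d) (tau : 'I_n -> R),
    [/\ convex_body K,
        forall i, 0 < tau i,
        injective (fun i => homothet K (x i) (tau i)),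
        NS_family K x tau
      & (exists l, is_lambda K x tau l /\ 1 < l) /\
        ~ (exists z, family_union K x tau `<=` homothet K z (\sum_i tau i))].
Proof.
case: d hd => [|[|d]] // _.
pose x (i : 'I_n) : 'rV[R]_d.+2 := windmill_corner d i.
pose tau (i : 'I_n) : R := windmill_ratio n i.
pose K := corner_simplex (0 : 'rV[R]_d.+2) 1.
exists K, x, tau.
have n0 : (0 < n)%N by exact: leq_trans hn.
have tau0 i : 0 < tau i by exact: windmill_ratio_gt0.
have member i : homothet K (x i) (tau i) = corner_simplex (x i) (tau i).
  exact: homothet_corner_simplex.
have main_member i (i3 : (i < 3)%N) :
    corner_simplex (windmill_corner d i) (8 / 25) =
    homothet K (x (Ordinal (leq_trans i3 hn))) (tau (Ordinal (leq_trans i3 hn))).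
  by rewrite member /x /tau /= /windmill_ratio i3.
have sum_lt1 : \sum_i tau i < 1 by exact: windmill_ratio_sum.
have sum_gt0 : 0 < \sum_i tau i.
  rewrite (bigD1 (Ordinal n0)) //= ltr_wpDr // sumr_ge0 // => i _; exact: ltW.
have cover_ge1 z s : 0 < s -> family_union K x tau `<=` homothet K z s -> 1 <= s.
  move=> s0; rewrite homothet_corner_simplex // => cov.
  apply: (windmill_cover d z) => i i3; rewrite main_member => y Ty.
  by apply: cov; exists (Ordinal (leq_trans i3 hn)).
split.
- exact: corner_simplex_convex_body.
- exact: tau0.
- move=> i j /=; rewrite !member => /corner_simplex_inj[] //; try exact: ltW.
  by move=> xij tij; apply/val_inj/(windmill_inj d n i j n0 xij tij).
- move=> _ [a [_ [b ->]]] [y [/= yb hully]]; apply: contrapT => miss.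
  have side := windmill_same_side d a b _.
  case: side => [i i3 p Tp pb|left|right].
  + by apply: miss; exists (Ordinal (leq_trans i3 hn)), p; rewrite -main_member.
  + suff : dot a y < b by rewrite /dot yb ltxx.
    apply: convex_hull_side hully => p [i _]; rewrite member.
    by have [j j3 sub] := windmill_member_sub (R := R) d n i n0 => /sub /left; exact.
  + suff : dot (- a) y < - b by rewrite dotNl /dot yb ltxx.
    apply: convex_hull_side hully => p [i _]; rewrite member dotNl ltrN2.
    by have [j j3 sub] := windmill_member_sub (R := R) d n i n0 => /sub /right; exact.
- split; last by move=> [z /(cover_ge1 z _ sum_gt0)]; lra.
  exists (\sum_i tau i)^-1; split; last by rewrite invf_gt1.
  split=> [|m [m0 [z]]].
    split; first by rewrite invr_gt0.
    exists 0; rewrite mulVf ?gt_eqF // homothet_corner_simplex // => y [i _].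
    by rewrite member; exact: windmill_sub_simplex.
  move=> /(cover_ge1 z _ (mulr_gt0 m0 sum_gt0)).
  by rewrite -ler_pdivrMr // div1r.
Qed.
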